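(* Let the elementary $\mathcal F$-expectation $\mathcal E_n$ satisfy (A$_{ind}$) and (A$_{tra}$). If there exists a function $g\in\widehat{\mathcal G}_n\cap\mathcal G^z_n\cap\mathcal G^0_n$ such that $\mathcal E_n[\xi|\mathcal F_t]=\mathcal E^g_n[\xi|\mathcal F_t]$ for all $t\in[0,T]$ and all $\xi\in\mathcal R_n$, then $\mathcal E_n$ satisfies (A$_{abs}$).
   Context: $(B_t)_{t\ge0}$ is a $d$-dimensional standard Brownian motion on a complete probability space $(\Omega,\mathcal F,P)$, $(\mathcal F_t)$ its natural filtration augmented by the $P$-null sets, $T>0$. Equalities between random variables hold a.s. $L^0_n(\mathcal F_t)$: $\mathbf R^n$-valued $\mathcal F_t$-measurable random variables. $\mathcal R_n=\{y+z(B_v-B_u):u,v\in[0,T],\,y\in\mathbf R^n,\,z\in\mathbf R^{n\times d}\}$. $\widehat{\mathcal G}_n\cap\mathcal G^z_n\cap\mathcal G^0_n$: deterministic measurable functions $g(t,z):[0,T]\times\mathbf R^{n\times d}\to\mathbf R^n$ with $\int_0^T|g(t,z)|dt<\infty$ for all $z$ and $g(t,0)=0$ for a.e. $t$. For such $g$, and for $\xi=y-\int_0^Tg(s,Z_s)ds+\int_0^TZ_sdB_s$ with $y\in\mathbf R^n$ and $Z$ a bounded deterministic measurable $\mathbf R^{n\times d}$-valued function with $\int_0^T|g(s,Z_s)|ds<\infty$, the conditional $g$-expectation is $\mathcal E^g_n[\xi|\mathcal F_t]:=Y_t$, where $Y_t=\xi+\int_t^Tg(s,Z_s)ds-\int_t^TZ_sdB_s$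 (this is well defined, and every $\xi\in\mathcal R_n$ is of this form). Elementary $\mathcal F$-expectation: a system of operators $\mathcal E_n[\cdot|\mathcal F_t]:L^0_n(\mathcal F_T)\to L^0_n(\mathcal F_t)$, $t\in[0,T]$, with (F1) $\mathcal E_n[\mathcal E_n[\xi|\mathcal F_t]|\mathcal F_s]=\mathcal E_n[\xi|\mathcal F_s]$ for $0\le s\le t\le T$; (F2) $\mathcal E_n[\xi|\mathcal F_t]=\xi$ if $\xi\in L^0_n(\mathcal F_t)$. $\mathcal E_n[\xi]:=\mathcal E_n[\xi|\mathcal F_0]$. (A$_{tra}$): for all $\xi\in L^0_n(\mathcal F_T)$, $t\in[0,T]$, $\eta\in L^0_n(\mathcal F_t)$: $\mathcal E_n[\xi+\eta|\mathcal F_t]=\mathcal E_n[\xi|\mathcal F_t]+\eta$. (A$_{ind}$): for all $z\in\mathbf R^{n\times d}$, $0\le t\le s\le T$: $\mathcal E_n[z(B_s-B_t)|\mathcal F_t]=\mathcal E_n[z(B_s-B_t)]$. (A$_{abs}$): $G(t,z):=\mathcal E_n[zB_t]$, $(t,z)\in[0,T]\times\mathbf R^{n\times d}$, is measurable, and for each $z$ it is absolutely continuous in $t$. *)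

(* Defs.v *)
From HB Require Import structures.
From mathcomp Require Import all_boot all_order all_algebra.
From mathcomp Require Import all_classical all_reals all_analysis.

Set Implicit Arguments.
Unset Strict Implicit.
Unset Printing Implicit Defensive.

Import Order.TTheory GRing.Theory Num.Theory.
Import numFieldNormedType.Exports.

Local Open Scope classical_set_scope.
Local Open Scope ring_scope.

(* The Borel sigma-algebra on m x n real matrices, presented (as the library
   does for tuples) as the one generated by the entries. *)
Definition matrix_entries_system (R : realType) (m n : nat) :
    set (set 'M[R]_(m, n)) :=
  \bigcup_(ij in [set: 'I_m * 'I_n])
    preimage_set_system setT (fun M : 'M[R]_(m, n) => M ij.1 ij.2) measurable.

Definition measure_matrix_display : measure_display.
Proof. exact: default_measure_display. Qed.

Section measurable_matrix.
Variables (R : realType) (m n : nat).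

Let matrix_measurable : set (set 'M[R]_(m, n)) :=
  <<s @matrix_entries_system R m n >>.

Let matrix_set0 : matrix_measurable set0.
Proof. exact: sigma_algebra0. Qed.

Let matrix_setC A : matrix_measurable A -> matrix_measurable (~` A).
Proof. exact: sigma_algebraC. Qed.

Let matrix_bigcup (F : _^nat) :
  (forall i, matrix_measurable (F i)) -> matrix_measurable (\bigcup_i (F i)).
Proof. exact: sigma_algebra_bigcup. Qed.

HB.instance Definition _ := @isMeasurable.Build measure_matrix_display
  'M[R]_(m, n) matrix_measurable matrix_set0 matrix_setC matrix_bigcup.

End measurable_matrix.

Section brownian.
Context {R : realType} {disp : measure_display} {Omega : measurableType disp}.
Variable P : probability Omega R.
Variable d : nat.
Implicit Type B : R -> Omega -> 'cV[R]_d.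

(* Events determined by a single B_u with 0 <= u <= t. *)
Definition past_events B (t : R) : set (set Omega) :=
  \bigcup_(u in `[0, t]) preimage_set_system setT (B u) measurable.

Definition aug_past_events B (t : R) : set (set Omega) :=
  past_events B t `|` [set N | P.-negligible N].

(* Only the values B t for 0 <= t matter.  The increment law says at once that
   B t - B s is independent of sigma(B u, u <= s) and that its coordinates are
   independent N(0, t - s); the second parameter of normal_prob is the standard
   deviation. *)
Record brownian_motion B : Prop := BrownianMotion {
  bm_measurable : forall t : R, 0 <= t -> measurable_fun setT (B t) ;
  bm_zero : B 0 = cst 0 %[ae P] ;
  bm_increment : forall s t : R, 0 <= s -> s < t ->
    forall A, <<s past_events B s >> A ->
    forall U : 'I_d -> set R, (forall i, measurable (U i)) ->
    P (A `&` [set w | forall i, U i ((B t w - B s w) i 0)]) =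
      (P A * \prod_(i < d) normal_prob 0 (Num.sqrt (t - s)) (U i))%E ;
  bm_continuous : \forall w \ae P,
    {within [set t : R | 0 <= t], continuous (fun t => B t w)} }.

(* xi belongs to L^0(F_t), F_t being the augmented natural filtration. *)
Definition L0 B (n : nat) (t : R) (xi : Omega -> 'cV[R]_n) : Prop :=
  measurable_fun setT (xi : g_sigma_algebraType (aug_past_events B t) -> 'cV[R]_n).

Definition Rn B (n : nat) (T : R) : set (Omega -> 'cV[R]_n) :=
  [set xi | exists (u v : R) (y : 'cV[R]_n) (z : 'M[R]_(n, d)),
     [/\ 0 <= u <= T, 0 <= v <= T &
         xi = (fun w => y + z *m (B v w - B u w))]].

(* A list of triples ((u, v), z) encodes the step function
   sum z * 1_(u, v]. *)
Definition step_fun (n : nat) (phi : seq (R * R * 'M[R]_(n, d))) (s : R) :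
    'M[R]_(n, d) :=
  \sum_(p <- phi) (if p.1.1 < s <= p.1.2 then p.2 else 0).

Definition step_integral B (n : nat) (phi : seq (R * R * 'M[R]_(n, d)))
    (w : Omega) : 'cV[R]_n :=
  \sum_(p <- phi) p.2 *m (B p.1.2 w - B p.1.1 w).

Definition steps_in (n : nat) (a b : R) (phi : seq (R * R * 'M[R]_(n, d))) :=
  all (fun p => [&& a <= p.1.1, p.1.1 <= p.1.2 & p.1.2 <= b]) phi.

(* I is a version of the stochastic integral of the deterministic integrand Z
   against B over [a, b]: an L^2-limit of integrals of step functions
   converging to Z in L^2. *)
Definition is_stochastic_integral B (n : nat) (a b : R)
    (Z : R -> 'M[R]_(n, d)) (I : Omega -> 'cV[R]_n) : Prop :=
  measurable_fun setT I /\
  exists phi : nat -> seq (R * R * 'M[R]_(n, d)),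
  [/\ forall k, steps_in a b (phi k),
      (\int[lebesgue_measure]_(s in `[a, b])
         (`|step_fun (phi k) s - Z s| ^+ 2)%:E)%E @[k --> \oo] --> 0%E &
      (\int[P]_w (`|step_integral B (phi k) w - I w| ^+ 2)%:E)%E
         @[k --> \oo] --> 0%E].

End brownian.

Definition vec_integral (R : realType) (n : nat) (a b : R)
    (f : R -> 'cV[R]_n) : 'cV[R]_n :=
  \col_i \int[lebesgue_measure]_(s in `[a, b]) f s i 0.

Definition is_generator (R : realType) (n d : nat) (T : R)
    (g : R -> 'M[R]_(n, d) -> 'cV[R]_n) : Prop :=
  [/\ measurable_fun (`[0, T] `*` setT) (fun p : R * 'M[R]_(n, d) => g p.1 p.2),
      forall z, ((\int[lebesgue_measure]_(t in `[0%R, T]) (`|g t z|)%:E) < +oo)%E &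
      \forall t \ae (@lebesgue_measure R), t \in `[0, T] -> g t 0 = 0].

Section expectations.
Context {R : realType} {disp : measure_display} {Omega : measurableType disp}.
Variable P : probability Omega R.
Variables (n d : nat) (B : R -> Omega -> 'cV[R]_d) (T : R).

(* Y is a version of the conditional g-expectation of xi at time t. *)
Definition is_cond_g_expectation (g : R -> 'M[R]_(n, d) -> 'cV[R]_n) (t : R)
    (xi Y : Omega -> 'cV[R]_n) : Prop :=
  exists (y : 'cV[R]_n) (Z : R -> 'M[R]_(n, d)) (I0 It : Omega -> 'cV[R]_n),
  [/\ measurable_fun `[0, T] Z,
      exists M : R, forall s : R, s \in `[0, T] -> `|Z s| <= M &
      ((\int[lebesgue_measure]_(s in `[0%R, T]) (`|g s (Z s)|)%:E) < +oo)%E] /\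
  [/\ is_stochastic_integral P B 0 T Z I0,
      is_stochastic_integral P B t T Z It,
      xi = (fun w => y - vec_integral 0 T (fun s => g s (Z s)) + I0 w)
        %[ae P] &
      Y = (fun w => xi w + vec_integral t T (fun s => g s (Z s)) - It w)
        %[ae P]].

Implicit Type E : R -> (Omega -> 'cV[R]_n) -> Omega -> 'cV[R]_n.

(* E t stands for E_n[ . | F_t].  Elements of L^0 are almost sure equivalence
   classes; E acts on representatives, whence the congruence condition. *)
Record elementary_expectation E : Prop := ElementaryExpectation {
  elem_L0 : forall (t : R) xi, 0 <= t <= T -> L0 P B T xi -> L0 P B t (E t xi) ;
  elem_ae : forall (t : R) xi xi', 0 <= t <= T -> L0 P B T xi -> L0 P B T xi' ->
    xi = xi' %[ae P] -> E t xi = E t xi' %[ae P] ;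
  elem_tower : forall (s t : R) xi, 0 <= s -> s <= t -> t <= T -> L0 P B T xi ->
    E s (E t xi) = E s xi %[ae P] ;
  elem_id : forall (t : R) xi, 0 <= t <= T -> L0 P B t xi -> E t xi = xi %[ae P] }.

Definition A_tra E : Prop :=
  forall (xi : Omega -> 'cV[R]_n) (t : R) (eta : Omega -> 'cV[R]_n),
    0 <= t <= T -> L0 P B T xi -> L0 P B t eta ->
    E t (fun w => xi w + eta w) = (fun w => E t xi w + eta w) %[ae P].

Definition A_ind E : Prop :=
  forall (z : 'M[R]_(n, d)) (t s : R), 0 <= t -> t <= s -> s <= T ->
    E t (fun w => z *m (B s w - B t w)) =
    E 0 (fun w => z *m (B s w - B t w)) %[ae P].

End expectations.

Definition absolutely_continuous (R : realType) (V : normedModType R)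
    (a b : R) (f : R -> V) : Prop :=
  forall eps : R, 0 < eps -> exists2 delta : R, 0 < delta &
    forall (m : nat) (l r : 'I_m -> R),
      (forall k, [/\ a <= l k, l k <= r k & r k <= b]) ->
      trivIset setT (fun k => `]l k, r k[%classic) ->
      \sum_(k < m) (r k - l k) < delta ->
      \sum_(k < m) `|f (r k) - f (l k)| < eps.

(* F_0 is P-trivial, so E_n[z B_t] = E_n[z B_t | F_0] is almost surely equal to
   a constant vector, which is unique and is the value G t z. *)
Definition A_abs (R : realType) (disp : measure_display)
    (Omega : measurableType disp) (P : probability Omega R) (n d : nat)
    (B : R -> Omega -> 'cV[R]_d) (T : R)
    (E : R -> (Omega -> 'cV[R]_n) -> Omega -> 'cV[R]_n) : Prop :=
  exists G : R -> 'M[R]_(n, d) -> 'cV[R]_n,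
  [/\ forall (t : R) z, 0 <= t <= T ->
        E 0 (fun w => z *m B t w) = cst (G t z) %[ae P],
      measurable_fun (`[0, T] `*` setT)
        (fun p : R * 'M[R]_(n, d) => G p.1 p.2) &
      forall z, absolutely_continuous 0 T (fun t => G t z)].

(* Main.v *)
(* The terminal value z (B_t - B_0), which is z B_t almost surely, has the step
   integrand Z = z 1_(0, t], and g(s, 0) = 0 for a.e. s, so its g-expectation at
   time 0 is the constant \int_0^t g(s, z) ds.  As a function of t this is an
   indefinite Lebesgue integral, hence absolutely continuous; joint
   measurability in (t, z) is Tonelli applied to the positive and negative parts
   of 1_{s <= t} g(s, z). *)
Require Import Defs.
From mathcomp Require Import all_boot all_order all_algebra.
From mathcomp Require Import all_classical all_reals all_analysis.
From mathcomp Require Import measurable_realfun.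

Set Implicit Arguments.
Unset Strict Implicit.
Unset Printing Implicit Defensive.

Import Order.TTheory GRing.Theory Num.Theory.
Import numFieldNormedType.Exports.

Local Open Scope classical_set_scope.
Local Open Scope ring_scope.

(** * Measurability of matrix-valued functions *)

Lemma measurable_mxP (R : realType) (m n : nat) (d : measure_display)
    (T : measurableType d) (D : set T) (f : T -> 'M[R]_(m, n)) :
  measurable_fun D f <-> forall i j, measurable_fun D (fun x => f x i j).
Proof.
split=> [mf i j|mf].
  have mij : measurable_fun setT (fun M : 'M[R]_(m, n) => M i j).
    move=> _ A mA; apply: sub_sigma_algebra.
    by exists (i, j) => //; exists A.
  exact: (measurableT_comp mij mf).
(* Preimages need checking only on a generating family, here the sets cut out by a single entry. *)
move=> mD; apply: (measurability (@matrix_entries_system R m n)) => //.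
move=> _ [_ [[i j] _ [A mA <-]] <-].
by rewrite setTI; exact: mf.
Qed.

Section measurable_matrix_operations.
Context (R : realType) (d : measure_display) (T : measurableType d) (D : set T).

(** The matrix norm is the maximum of the absolute entries, so induction over the list of index
    pairs reduces it to binary maxima. *)
Lemma measurable_mx_norm (m n : nat) (f : T -> 'M[R]_(m, n)) :
  measurable_fun D f -> measurable_fun D (fun x => `|f x|).
Proof.
move=> /measurable_mxP mf.
under eq_fun do rewrite [`|_|]mx_normrE.
elim: (index_enum _) => [|[i j] s IH].
  by under eq_fun do rewrite big_nil; exact: measurable_cst.
under eq_fun do rewrite big_cons.
by apply: measurable_maxr => //; apply: measurableT_comp => //; exact: mf.
Qed.

Lemma measurable_mulmx (m n p : nat) (z : 'M[R]_(m, n))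
    (f : T -> 'M[R]_(n, p)) :
  measurable_fun D f -> measurable_fun D (fun x => z *m f x).
Proof.
move=> /measurable_mxP mf; apply/measurable_mxP => i j.
under eq_fun do rewrite mxE.
by apply: measurable_sum => k; apply: measurable_funM.
Qed.

Lemma measurable_mxB (m n : nat) (f g : T -> 'M[R]_(m, n)) :
  measurable_fun D f -> measurable_fun D g ->
  measurable_fun D (fun x => f x - g x).
Proof.
move=> /measurable_mxP mf /measurable_mxP mg; apply/measurable_mxP => i j.
by under eq_fun do rewrite !mxE; exact: measurable_funB.
Qed.

End measurable_matrix_operations.

(** * Componentwise integrals as functions of their upper limit and of a parameter *)

Lemma normr_mx_entry (R : realType) (m n : nat) (M : 'M[R]_(m, n)) i j :
  `|M i j| <= `|M|.
Proof.
rewrite [`|M|]mx_normrE.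
exact: (le_bigmax _ (fun ij => `|M ij.1 ij.2|) (i, j)).
Qed.

Lemma normr_mx_le (R : realType) (m n : nat) (M : 'M[R]_(m, n)) (c : R) :
  0 <= c -> (forall i j, `|M i j| <= c) -> `|M| <= c.
Proof. by move=> c0 Mc; rewrite [`|M|]mx_normrE; apply/bigmax_leP. Qed.

Section vector_integral.
Context (R : realType) (n : nat) (T : R).
Implicit Type f : R -> 'cV[R]_n.
Local Notation mu := (@lebesgue_measure R).

(** Stated through the norm, as in [is_generator]; the norm dominates every entry, so each component
    is then integrable. *)
Definition vec_integrable f :=
  measurable_fun `[0, T] f /\
  ((\int[lebesgue_measure]_(t in `[0%R, T]) (`|f t|)%:E) < +oo)%E.

Lemma integrable_normr_vec f : vec_integrable f ->
  mu.-integrable `[0, T] (EFin \o (fun s => `|f s|)).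
Proof.
move=> [mf foo]; apply/integrableP; split.
  by apply/measurable_EFinP; exact: measurable_mx_norm.
by under eq_integral do rewrite /= normr_id.
Qed.

Lemma integrable_vec_entry f i : vec_integrable f ->
  mu.-integrable `[0, T] (EFin \o (fun s => f s i 0)).
Proof.
move=> fint; apply: le_integrable (integrable_normr_vec fint) => //.
  by case: fint => mf _; apply/measurable_EFinP; move/measurable_mxP : mf; exact.
by move=> s _; rewrite /= lee_fin normr_id normr_mx_entry.
Qed.

(** The bound is over an open interval because [absolutely_continuous] asks for disjointness of open
    intervals only; the end point [r] is a null set. *)
Lemma vec_integralB_le f (l r : R) : vec_integrable f ->
  0 <= l -> l <= r -> r <= T ->
  `|vec_integral 0 r f - vec_integral 0 l f| <=
    \int[mu]_(s in `]l, r[) `|f s|.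
Proof.
move=> fint l0 lr rT.
have sub0 : `[0, r] `<=` `[0, T].
  by apply: subset_itvl; rewrite bnd_simp.
have sub1 : `]l, r] `<=` `[0, T].
  by apply: subset_itv; rewrite bnd_simp.
have sub2 : `]l, r[ `<=` `[0, T].
  by apply: subset_itv; rewrite bnd_simp.
apply: normr_mx_le => [|i j]; first exact: Rintegral_ge0.
rewrite !mxE Rintegral_itvB ?bnd_simp//; last first.
  by apply: (@integrableS _ _ _ mu `[0, T]) => //;
    exact: integrable_vec_entry i fint.
apply: le_trans (le_normr_Rintegral _ _) _ => //.
  by apply: (@integrableS _ _ _ mu `[0, T]) => //;
    exact: integrable_vec_entry i fint.
rewrite Rintegral_itv_bndo_bndc//; last first.
  by apply: (@integrableS _ _ _ mu `[0, T]) => //;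
    exact: integrable_normr_vec fint.
apply: le_Rintegral => //.
- apply: (@integrableS _ _ _ mu `[0, T]) => //.
  exact: (integrable_abse (integrable_vec_entry i fint)).
- by apply: (@integrableS _ _ _ mu `[0, T]) => //;
    exact: integrable_normr_vec fint.
- by move=> s _; exact: normr_mx_entry.
Qed.

(** The integral of an integrable function over a set is small once the measure of the set is small;
    this is applied to the union of the given intervals. *)
Lemma absolutely_continuous_vec_integral f : vec_integrable f ->
  absolutely_continuous 0 T (fun t => vec_integral 0 t f).
Proof.
move=> fint e e0.
(* Extension by zero gives an integrable function on the whole line, as [integral_normr_continuous]
   is applied there. *)
pose h := (fun s => `|f s|) \_ `[0, T].
have hint : mu.-integrable setT (EFin \o h).
  rewrite /h -restrict_EFin; apply/integrable_restrict => //.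
  by rewrite setTI; exact: integrable_normr_vec.
have [delta [delta0 Hdelta]] := integral_normr_continuous hint e0.
exists delta => // m l r lr lrtriv sumlr.
pose A := \big[setU/set0]_(k < m) `]l k, r k[%classic.
have mA : measurable A by apply: bigsetU_measurable.
have triv : trivIset [set` index_enum 'I_m] (fun k => `]l k, r k[%classic).
  exact: sub_trivIset lrtriv.
have muA : (mu A < delta%:E)%E.
  (* The measure of [A] is the integral of 1 over a disjoint union, hence the sum of the lengths. *)
  rewrite -[mu A]mul1e -integral_cst// ge0_integral_bigsetU ?index_enum_uniq//.
  rewrite (eq_bigr (fun k => (r k - l k)%:E)) ?sumEFin ?lte_fin// => k _.
  have [_ lrk _] := lr k.
  rewrite integral_cst// mul1e; apply: etrans (lebesgue_measure_itv _) _ => /=.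
  (* An empty interval has [l k = r k], so its length [r k - l k] is still its measure. *)
  rewrite lte_fin EFinB; case: ltP => // rl.
  by rewrite (@le_anti _ _ (l k) (r k)) ?lrk ?rl// -EFinB subrr.
apply: le_lt_trans (Hdelta A mA muA).
have -> : \int[mu]_(x in A) `|h x| =
    \sum_(k < m) \int[mu]_(x in `]l k, r k[) `|h x|.
  rewrite /Rintegral ge0_integral_bigsetU ?index_enum_uniq//; last first.
    apply: measurable_funTS.
    exact: (measurable_int mu (integrable_abse hint)).
  rewrite -sum_fine// => k _; apply: integrable_fin_num => //.
  apply: (integrableS measurableT) => //; exact: integrable_abse hint.
apply: ler_sum => k _; have [l0 lrk rT] := lr k.
apply: le_trans (vec_integralB_le fint l0 lrk rT) _.
rewrite le_eqVlt; apply/orP; left; apply/eqP; apply: eq_Rintegral => s.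
rewrite inE/= in_itv/= => /andP[ls sr].
rewrite /h patchE ifT ?normr_id// inE/= in_itv/=.
by rewrite (le_trans l0 (ltW ls)) (le_trans (ltW sr) rT).
Qed.

End vector_integral.

Lemma measurable_vec_integral (R : realType) (n : nat) (d : measure_display)
    (U : measurableType d) (T : R) (g : R -> U -> 'cV[R]_n) :
  measurable_fun (`[0, T] `*` setT) (fun p : R * U => g p.1 p.2) ->
  measurable_fun (`[0, T] `*` setT)
    (fun p : R * U => vec_integral 0 p.1 (fun s => g s p.2)).
Proof.
move=> /measurable_mxP mg; apply/measurable_mxP => i j.
have mD : measurable (`[0, T] `*` setT : set (R * U)) by exact: measurableX.
pose h := (fun p : R * U => g p.1 p.2 i 0) \_ (`[0, T] `*` setT).
have mh : measurable_fun setT h by apply/(measurable_restrictT _ mD).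
(* With [q = ((t, z), s)], the moving upper limit [t] becomes the indicator of [s <= t], so that the
   domain of integration no longer depends on the parameter. *)
pose K (q : (R * U) * R) := (if q.2 <= q.1.1 then h (q.2, q.1.2) else 0)%:E.
have mK : measurable_fun setT K.
  apply/measurable_EFinP; apply: measurable_fun_ifT => //.
    apply: measurable_fun_ler => //.
    exact: (measurableT_comp measurable_fst measurable_fst).
  apply: (measurableT_comp mh); apply: measurable_fun_pair => //.
  exact: (measurableT_comp measurable_snd measurable_fst).
have mpart (F : (R * U) * R -> \bar R) : measurable_fun setT F ->
    (forall q, 0 <= F q)%E ->
    measurable_fun setT (fun p => \int[lebesgue_measure]_s F (p, s))%E.
  move=> mF F0.
  exact: (@measurable_fun_fubini_tonelli_F _ _ _ _ R lebesgue_measure F mF F0).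
apply: (@eq_measurable_fun _ _ _ _ _
    (fun p => fine (\int[lebesgue_measure]_s K (p, s))%E)).
  move=> [t z]; rewrite inE/= in_itv/= => -[/andP[t0 tT] _].
  rewrite mxE /Rintegral [in RHS]integral_mkcond; congr fine.
  apply: eq_integral => s _; rewrite /K /h !patchE /=.
  (* Both integrands vanish for [s > t] and for [s < 0]; in between, [t <= T] keeps [s] in the
     domain where [h] agrees with [g]. *)
  have [st|ts] := leP s t; last first.
    by case: ifP => //; rewrite inE/= in_itv/= => /andP[_]; rewrite leNgt ts/=.
  have [s0|s0] := leP 0 s; last first.
    case: ifP => [|_]; first by rewrite inE/= => -[]; rewrite in_itv/= leNgt s0.
    by case: ifP => //; rewrite inE/= in_itv/= leNgt s0.
  rewrite !ifT// inE/= in_itv/= s0//=.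
  by rewrite (le_trans st tT).
apply: measurable_funTS; apply: measurableT_comp => //.
(* Tonelli covers nonnegative integrands only, and the integral of [K] is by definition the
   difference of those of its two parts. *)
have mP := mpart (K^\+)%E (measurable_funepos mK) (funepos_ge0 K).
have mN := mpart (K^\-)%E (measurable_funeneg mK) (funeneg_ge0 K).
apply: eq_measurable_fun (emeasurable_funB mP mN) => p _.
rewrite [RHS]integralE.
by congr (_ - _)%E; apply: eq_integral => s _; rewrite ?funeposE ?funenegE.
Qed.

(** * The generator evaluated along a step integrand *)

Section generator.
Context (R : realType) (n d : nat) (T : R) (g : R -> 'M[R]_(n, d) -> 'cV[R]_n).
Hypothesis gG : is_generator T g.

Lemma measurable_generator_comp (Z : R -> 'M[R]_(n, d)) :
  measurable_fun setT Z -> measurable_fun `[0, T] (fun s => g s (Z s)).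
Proof.
move=> mZ; have [mg _ _] := gG.
have mpair : measurable_fun setT (fun s : R => (s, Z s)).
  exact: measurable_fun_pair.
apply: (measurable_comp _ _ mg (measurable_funTS mpair)).
  exact: measurableX.
by move=> _ [s sT <-].
Qed.

Lemma vec_integrable_generator z : vec_integrable T (g ^~ z).
Proof.
split; first exact: (measurable_generator_comp (Z := cst z)).
by case: gG.
Qed.

End generator.

Lemma measurable_step_fun (R : realType) (n d : nat)
    (phi : seq (R * R * 'M[R]_(n, d))) : measurable_fun setT (step_fun phi).
Proof.
apply/measurable_mxP => i j.
under eq_fun do rewrite /step_fun summxE.
apply: measurable_sum => p.
rewrite (_ : (fun s => _) =
  (fun s => if p.1.1 < s <= p.1.2 then p.2 i j else 0)); last first.
  by apply/funext => s; case: ifP => //; rewrite mxE.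
apply: measurable_fun_ifT => //.
by apply: measurable_and; [exact: measurable_fun_ltr|exact: measurable_fun_ler].
Qed.

Section step_integrand.
Context (R : realType) (n d : nat) (T : R) (g : R -> 'M[R]_(n, d) -> 'cV[R]_n).
Hypothesis gG : is_generator T g.
Variables (t : R) (z : 'M[R]_(n, d)).
Hypothesis t0T : 0 <= t <= T.
Let Z := step_fun [:: ((0, t), z)].

Lemma step_fun1E s : Z s = if 0 < s <= t then z else 0.
Proof. by rewrite /Z /step_fun big_seq1. Qed.

(** The integrand takes only the values [g s z] and [g s 0], so the sum of their norms dominates
    it. *)
Lemma integrable_generator_step :
  ((\int[lebesgue_measure]_(s in `[0%R, T]) (`|g s (Z s)|)%:E) < +oo)%E.
Proof.
have int x := integrable_normr_vec (vec_integrable_generator gG x).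
have /integrableP[_] : lebesgue_measure.-integrable `[0, T]
    (EFin \o (fun s => `|g s (Z s)|)).
  apply: le_integrable (integrableD _ (int z) (int 0)) => //.
    apply/measurable_EFinP/measurable_mx_norm.
    exact: (measurable_generator_comp gG (measurable_step_fun _)).
  move=> s _; rewrite /= lee_fin normr_id ger0_norm ?addr_ge0// step_fun1E.
  by case: ifP => _; rewrite ?lerDl ?lerDr.
by under eq_integral do rewrite /= normr_id.
Qed.

(** Beyond [t] the integrand is [g s 0], which vanishes almost everywhere, so only the integral over
    [[0, t]] survives. *)
Lemma vec_integral_generator_step :
  vec_integral 0 T (fun s => g s (Z s)) = vec_integral 0 t (g ^~ z).
Proof.
have [t0 tT] := andP t0T.
apply/matrixP => i j; rewrite !mxE.
have -> : `[0, t]%classic = `[0, T] `&` `[0, t].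
  by rewrite setIidr//; apply: subset_itvl; rewrite bnd_simp.
rewrite Rintegral_mkcondr /Rintegral; congr fine.
apply: ae_eq_integral => //.
- apply/measurable_EFinP.
  move: (measurable_generator_comp gG (measurable_step_fun [:: ((0, t), z)])).
  by move/measurable_mxP; exact.
- suff : lebesgue_measure.-integrable `[0, T]
      ((EFin \o (fun s => g s z i 0)) \_ `[0, t]).
    by rewrite restrict_EFin; exact: measurable_int.
  apply/integrable_restrict => //.
  apply: (@integrableS _ _ _ lebesgue_measure `[0, T]) => //.
    by apply: measurableI.
  exact: (integrable_vec_entry i (vec_integrable_generator gG z)).
have [_ _ g0] := gG.
(* The step function lives on the half-open []0, t]] and the integral on the closed [[0, t]]; the
   two differ at the point 0, which is null. *)
have s0 : \forall s \ae (@lebesgue_measure R), s != 0.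
  exists [set 0]; split => //; first exact: lebesgue_measure_set1.
  by move=> s /= /negP/negPn/eqP.
have aeF := ae_filter_ringOfSetsType (@lebesgue_measure R).
apply: filterS2 g0 s0 => s g0 s0 sT.
congr EFin; rewrite patchE step_fun1E.
move: (sT); rewrite /= in_itv/= => /andP[s_ge0 _].
have -> : (s \in `[0, t]%classic) = (s <= t).
  by rewrite mem_setE in_itv/= s_ge0.
rewrite lt_neqAle eq_sym s0 s_ge0/=.
by case: ifP => // _; rewrite g0// mxE.
Qed.

End step_integrand.

(** * Stochastic integrals of step functions and adaptedness *)

Section brownian_steps.
Context {R : realType} {disp : measure_display} {Omega : measurableType disp}.
Context (P : probability Omega R) (d : nat) (B : R -> Omega -> 'cV[R]_d).

(** A step function approximates itself: along the constant sequence [phi] both L^2 distances are 0.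
    Measurability of the integral is an induction on [phi], where [0 <= a] ensures that only
    nonnegative times occur. *)
Lemma is_stochastic_integral_step (n : nat) (a b : R)
    (phi : seq (R * R * 'M[R]_(n, d))) :
  brownian_motion P B -> 0 <= a -> steps_in a b phi ->
  is_stochastic_integral P B a b (step_fun phi) (step_integral B phi).
Proof.
move=> bmB a0 phiab; split; last first.
  exists (fun=> phi); split => //.
    under eq_fun do under eq_integral do rewrite subrr normr0 expr0n/=.
    by rewrite integral0; exact: cvg_cst.
  under eq_fun do under eq_integral do rewrite subrr normr0 expr0n/=.
  by rewrite integral0; exact: cvg_cst.
elim: phi phiab => [_|p phi IH /=/andP[/and3P[ap p12 _] phiab]].
  rewrite (_ : step_integral B [::] = cst 0); first exact: measurable_cst.
  by apply/funext => w; rewrite /step_integral big_nil.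
have mB u : a <= u -> measurable_fun setT (B u).
  by move=> au; apply: (bm_measurable bmB); exact: le_trans au.
have mp : measurable_fun setT (fun w => p.2 *m (B p.1.2 w - B p.1.1 w)).
  apply/measurable_mulmx/measurable_mxB; apply: mB => //.
  exact: le_trans p12.
apply/measurable_mxP => i j.
rewrite (_ : (fun w => _) = (fun w =>
  (p.2 *m (B p.1.2 w - B p.1.1 w)) i j + step_integral B phi w i j)); last first.
  by apply/funext => w; rewrite /step_integral big_cons mxE.
move/measurable_mxP : mp => mp; have /measurable_mxP mI := IH phiab.
exact: measurable_funD.
Qed.

Lemma L0_past (t u : R) : 0 <= u <= t -> L0 P B t (B u).
Proof.
move=> ut _ A mA; apply: sub_sigma_algebra; left.
by exists u; [rewrite /= in_itv|exists A].
Qed.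

(** [L0] is measurability for the augmented past on [Omega], so the general matrix lemmas apply with
    that sigma-algebra on the source. *)
Lemma L0_mulmx (n : nat) (t : R) (z : 'M[R]_(n, d)) xi :
  L0 P B t xi -> L0 P B t (fun w => z *m xi w).
Proof. exact: measurable_mulmx. Qed.

Lemma L0_sub (n : nat) (t : R) (xi eta : Omega -> 'cV[R]_n) :
  L0 P B t xi -> L0 P B t eta -> L0 P B t (fun w => xi w - eta w).
Proof. exact: measurable_mxB. Qed.

End brownian_steps.

Theorem proposition4p4 (R : realType) (n d : nat) (disp : measure_display)
    (Omega : measurableType disp) (P : probability Omega R)
    (B : R -> Omega -> 'cV[R]_d) (T : R)
    (E : R -> (Omega -> 'cV[R]_n) -> Omega -> 'cV[R]_n) :
  measure_is_complete P ->
  brownian_motion P B ->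
  0 < T ->
  elementary_expectation P B T E ->
  A_ind P B T E ->
  A_tra P B T E ->
  (exists g : R -> 'M[R]_(n, d) -> 'cV[R]_n,
     is_generator T g /\
     forall (t : R) (xi Y : Omega -> 'cV[R]_n),
       0 <= t <= T -> Rn B T xi ->
       is_cond_g_expectation P B T g t xi Y -> E t xi = Y %[ae P]) ->
  A_abs P B T E.
Proof.
move=> _ bmB T0 elE _ _ [g [gG Eg]].
exists (fun t z => vec_integral 0 t (g ^~ z)); split; last 2 first.
- by apply: (measurable_vec_integral (g := g)); case: gG.
- by move=> z; apply: absolutely_continuous_vec_integral;
    exact: vec_integrable_generator.
move=> t z tT; have [t_ge0 t_leT] := andP tT.
have T00 : (0 : R) <= 0 <= T by rewrite lexx ltW.
pose phi : seq (R * R * 'M[R]_(n, d)) := [:: ((0, t), z)].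
pose xi w := z *m (B t w - B 0 w).
have phiT : steps_in 0 T phi by rewrite /= lexx t_ge0 t_leT.
have IE : step_integral B phi = xi.
  by apply/funext => w; rewrite /step_integral big_seq1.
(* [B 0] vanishes only almost surely, so [z *m B t] is exchanged for the increment [xi], which has
   the exact form required by [Rn]. *)
have EzB : E 0 (fun w => z *m B t w) = E 0 xi %[ae P].
  apply: (elem_ae elE) => //.
  - by apply: L0_mulmx; exact: L0_past.
  - apply: L0_mulmx; apply: L0_sub; first exact: L0_past.
    by apply: L0_past; rewrite lexx ltW.
  - by apply: filterS (bm_zero bmB) => w B0 _; rewrite /xi B0// subr0.
have Exi : E 0 xi = cst (vec_integral 0 t (g ^~ z)) %[ae P].
  apply: Eg => //.
    exists 0, t, 0, z; split=> //.
    by apply/funext => w; rewrite add0r.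
  have stI := is_stochastic_integral_step bmB (lexx 0) phiT.
  (* The constant [y] is chosen to cancel the drift, so that [y] minus the drift plus the stochastic
     integral is [xi]. At time 0 both stochastic integrals run over [[0, T]] and equal [xi], leaving
     the drift alone as the conditional value. *)
  exists (vec_integral 0 T (fun s => g s (step_fun phi s))), (step_fun phi),
    (step_integral B phi), (step_integral B phi).
  split; split => //.
  - by apply: measurable_funTS; exact: measurable_step_fun.
  - exists `|z| => s _; rewrite step_fun1E.
    by case: ifP => _; rewrite ?normr0.
  - exact: integrable_generator_step.
  - by apply: aeW => w _; rewrite IE subrr add0r.
  - apply: aeW => w _; rewrite IE vec_integral_generator_step//.
    by rewrite addrAC subrr add0r.
by apply: filterS2 EzB Exi => w Ew Exw _; rewrite Ew// Exw.
Qed.
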